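(* For all integers $n$ and $k$ with $2\leq k\leq n-1$, $f(n,k)=\binom{n-k-1}{2}+k+2$.
   Context: All graphs are simple, undirected and finite. A path in an edge-colored graph is a conflict-free path if some color is used on exactly one of its edges. An edge-colored graph is conflict-free connected if every pair of distinct vertices is joined by a conflict-free path. The conflict-free connection number $\mathit{cfc}(G)$ of a connected graph $G$ is the smallest number of colors in an edge-coloring of $G$ making $G$ conflict-free connected. For integers $2\leq k\leq n-1$, $f(n,k)$ is the minimum integer such that every connected graph $G$ of order $n$ with $|E(G)|\geq f(n,k)$ satisfies $\mathit{cfc}(G)\leq k$.
   Formalization: For k = n-1 every connected graph of order n has cfc(G) ≤ n-1, so every integer is a valid threshold and the minimum f(n,n-1) does not exist; the formula is proved for 2 ≤ k ≤ n-2, and for k = n-1 only conditionally on f(n,k) existing. *)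

(* Defs.v *)
From mathcomp Require Import all_boot all_order all_algebra.
From mathcomp Require Import boolp.

Set Implicit Arguments.
Unset Strict Implicit.
Unset Printing Implicit Defensive.

Record sgraph := SGraph {
  vertex :> finType;
  adj : rel vertex;
  adj_sym : symmetric adj;
  adj_irrefl : irreflexive adj }.

Definition edges (G : sgraph) : {set {set G}} :=
  [set [set x; y] | x in G, y in G & adj x y].

Definition connected (G : sgraph) : Prop :=
  forall x y : G, connect (@adj G) x y.

(* The vertices of the path are x :: p. *)
Definition is_path (G : sgraph) (x y : G) (p : seq G) : bool :=
  [&& path (@adj G) x p, last x p == y & uniq (x :: p)].

Definition path_edges (G : sgraph) (x : G) (p : seq G) : seq {set G} :=
  pairmap (fun u v : G => [set u; v]) x p.

(* A colouring is a total function on vertex sets, of which only the values on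
   [edges G] matter. *)
Definition conflict_free (G : sgraph) (col : {set G} -> nat) (x : G)
    (p : seq G) : Prop :=
  exists a : nat, count (fun e => col e == a) (path_edges x p) = 1.

Definition conflict_free_connected (G : sgraph) (col : {set G} -> nat) : Prop :=
  forall x y : G, x != y ->
    exists2 p : seq G, is_path x y p & conflict_free col x p.

Definition cf_colorable (G : sgraph) (c : nat) : Prop :=
  exists2 col : {set G} -> nat,
    (forall e, e \in edges G -> col e < c) & conflict_free_connected col.

Lemma notin_path_edges (G : sgraph) (x z : G) (p : seq G) (e : {set G}) :
  x \notin z :: p -> e \in path_edges z p -> x \notin e.
Proof.
elim: p z => [//|w p IH] z; rewrite inE negb_or => /andP[xz xp].
rewrite inE => /orP[/eqP ->|]; last exact: IH.
by move: xp; rewrite !inE !negb_or xz => /andP[-> _].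
Qed.

(* Give all edges distinct colours. *)
Lemma connected_cf_colorable (G : sgraph) :
  connected G -> exists c : nat, `[< cf_colorable G c >].
Proof.
move=> Gc; exists #|{set G}|; apply/asboolP.
exists (fun e => enum_rank e : nat) => [e _|x y xy]; first exact: ltn_ord.
have /connectP[q qP qy] := Gc x y.
case/shortenP: qP qy => p pP pU _ py.
exists p; first by rewrite /is_path pP -py eqxx pU.
case: p pP pU py => [_ _ yx|z p _ /= /andP[xp _] _].
  by rewrite yx eqxx in xy.
exists (enum_rank [set x; z] : nat); rewrite /path_edges /= eqxx.
apply/eqP; rewrite eqSS eqn0Ngt -has_count; apply/hasPn => e ep.
apply: contra (notin_path_edges xp ep) => /eqP/val_inj/enum_rank_inj ->.
exact: set21.
Qed.

Definition cfc (G : sgraph) (Gconn : connected G) : nat :=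
  ex_minn (connected_cf_colorable Gconn).

Definition cfc_edge_bound (n k : nat) (m : int) : Prop :=
  forall (G : sgraph) (Gconn : connected G),
    #|G| = n -> (m <= #|edges G|%:Z)%R -> cfc Gconn <= k.

(* [is_f n k m] reads "f(n,k) = m".  It is a relation because the minimum does
   not exist when every integer satisfies [cfc_edge_bound n k], which is the
   case for k = n - 1: there cfc(G) <= n - 1 for every connected G of order n. *)
Definition is_f (n k : nat) (m : int) : Prop :=
  cfc_edge_bound n k m /\
  forall m' : int, cfc_edge_bound n k m' -> (m <= m')%R.

(* Main.v *)
(* Upper bound. A connected graph with at most k bridges, k >= 2, has cfc <= k.
   Fix a spanning tree T; give the bridges distinct colours 0, 1, ..., the other
   edges of T colour 0 and the edges outside T colour 1. If the path of T from x
   to y has a bridge of positive colour, that colour occurs once on it; if all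
   its edges are bridges, any of its colours does. Otherwise it has a non-bridge
   f, and replacing f by an edge outside T reconnecting T - f gives a path with
   exactly one edge outside T; its bridges lie on the path of T, so they have
   colour 0, and colour 1 occurs once.
   Deleting k + 1 bridges leaves at least k + 2 components, so by convexity of
   binomials a graph with more than k bridges has at most C(n-k-1, 2) + k + 1
   edges.
   Lower bound. In K_(n-k-1) with k + 1 pendant edges at one vertex, the pendant
   edges need pairwise distinct colours. *)
Require Import Defs.
From mathcomp Require Import all_boot all_order all_algebra.
From mathcomp Require Import boolp zify.

Set Implicit Arguments.
Unset Strict Implicit.
Unset Printing Implicit Defensive.

(** * Edge sets as graphs on a fixed vertex set *)

(** With a graph given by its edge set, deleting edges is set difference and the vertex type stays
    the same. *)
Definition edge_rel (V : finType) (F : {set {set V}}) : rel V :=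
  fun x y => [set x; y] \in F.

Definition spanning (V : finType) (F : {set {set V}}) : bool :=
  [forall x, forall y, connect (edge_rel F) x y].

Definition bridges (G : sgraph) : {set {set G}} :=
  [set e in edges G | ~~ spanning (edges G :\ e)].

Section EdgeSets.
Variable V : finType.
Implicit Types (F : {set {set V}}) (a b x y w : V).

Lemma spanningP F : reflect (forall x y, connect (edge_rel F) x y) (spanning F).
Proof. by apply: (iffP forallP) => h x; apply/forallP. Qed.

Lemma edge_rel_sym F : symmetric (edge_rel F).
Proof. by move=> x y; rewrite /edge_rel setUC. Qed.

Lemma edge_connect_sym F : connect_sym (edge_rel F).
Proof. exact/sym_connect_sym/edge_rel_sym. Qed.

Lemma edge_connect_sub F F' x y :
  F \subset F' -> connect (edge_rel F) x y -> connect (edge_rel F') x y.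
Proof.
by move=> /subsetP sF; apply: connect_sub => u v uv; apply/connect1/sF.
Qed.

(** Along a walk from [a], a step other than the deleted edge keeps the end reachable from the same
    vertex, and a step across the deleted edge ends in [a] or [b]. *)
Lemma connect_del_edge F a b w : connect (edge_rel F) a w ->
  connect (edge_rel (F :\ [set a; b])) a w
  || connect (edge_rel (F :\ [set a; b])) b w.
Proof.
move=> /connectP[p pP ->] {w}; elim/last_ind: p pP => [|p w IH].
  by rewrite connect0.
rewrite rcons_path last_rcons => /andP[/IH IHp lw].
have [eq_lw|neq_lw] := eqVneq [set last a p; w] [set a; b].
  have : w \in [set a; b] by rewrite -eq_lw set22.
  by rewrite !inE => /orP[]/eqP->; rewrite connect0 ?orbT.
have stp : connect (edge_rel (F :\ [set a; b])) (last a p) w.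
  by apply/connect1; rewrite /edge_rel in_setD1 neq_lw.
by case/orP: IHp => h; rewrite (connect_trans h stp) ?orbT.
Qed.

(** Used contrapositively: an edge whose deletion disconnects separates its own two ends. *)
Lemma spanning_del_edge F a b :
  spanning F -> connect (edge_rel (F :\ [set a; b])) a b ->
  spanning (F :\ [set a; b]).
Proof.
move=> /spanningP Fs ab.
have a_to w : connect (edge_rel (F :\ [set a; b])) a w.
  by case/orP: (connect_del_edge b (Fs a w)) => // /(connect_trans ab).
by apply/spanningP => x y; apply: connect_trans (a_to y);
  rewrite edge_connect_sym.
Qed.

Lemma crossing_edge F (X : {set V}) x y :
    connect (edge_rel F) x y -> x \in X -> y \notin X ->
  exists u v, [/\ [set u; v] \in F, u \in X & v \notin X].
Proof.
move=> /connectP[p pP ->]; elim: p x pP => [|z p IH] x /=.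
  by move=> _ ->.
move=> /andP[xz zp] xX; have [/IH|zX _] := boolP (z \in X); first exact.
by exists x, z.
Qed.

End EdgeSets.

(** * Simple paths and their edges *)

Section Graphs.
Variable G : sgraph.
Implicit Types (F D T : {set {set G}}) (e f : {set G}) (x y u v : G).

Lemma mem_edges x y : ([set x; y] \in edges G) = adj x y.
Proof.
apply/imset2P/idP => [[a b _]|xy]; last by exists x y; rewrite ?inE.
rewrite inE => ab E.
have := set21 x y; have := set22 x y; rewrite E !inE.
have := set21 a b; have := set22 a b; rewrite -E !inE.
have nab : a != b by apply: contraTneq ab => ->; rewrite adj_irrefl.
move=> /orP[]/eqP bE /orP[]/eqP aE; subst; rewrite ?eqxx // in nab *.
by rewrite adj_sym.
Qed.

Lemma edgesP e : e \in edges G -> exists x y, e = [set x; y].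
Proof. by case/imset2P => x y _ _ ->; exists x, y. Qed.

Lemma spanning_edges : connected G -> spanning (edges G).
Proof.
move=> Gc; apply/spanningP => x y.
rewrite (eq_connect (e' := @adj G)) => [|a b]; first exact: Gc.
by rewrite /edge_rel mem_edges.
Qed.

Lemma path_edgesE F x p :
  path (edge_rel F) x p = all [in F] (path_edges x p).
Proof. by elim: p x => //= y p IH x; rewrite IH. Qed.

Lemma path_edges_cat x p q :
  path_edges x (p ++ q) = path_edges x p ++ path_edges (last x p) q.
Proof. exact: pairmap_cat. Qed.

Lemma path_edges_uniq x p : uniq (x :: p) -> uniq (path_edges x p).
Proof.
elim: p x => //= y p IH x /andP[xyp yp]; rewrite (IH y yp) andbT.
by apply/negP => /(notin_path_edges xyp); rewrite set21.
Qed.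

Lemma path_edges_split x p e : e \in path_edges x p ->
  exists q b r, p = q ++ b :: r /\ e = [set last x q; b].
Proof.
elim: p x => //= y p IH x; rewrite inE => /orP[/eqP->|/IH[q [b [r [-> ->]]]]].
  by exists [::], y, p.
by exists (y :: q), b, r.
Qed.

Lemma simple_path_connect F x y :
  connect (edge_rel F) x y ->
  exists p, [/\ path (edge_rel F) x p, last x p = y & uniq (x :: p)].
Proof.
by move=> /connectP[p /shortenP[q qP qU _] ->]; exists q.
Qed.

(** A simple path uses [e] only once, so its pieces before and after [e] survive in [F :\ e]. *)
Lemma path_edge_sides F x p e :
    path (edge_rel F) x p -> uniq (x :: p) -> e \in path_edges x p ->
  exists a b, [/\ e = [set a; b], connect (edge_rel (F :\ e)) x a
                & connect (edge_rel (F :\ e)) b (last x p)].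
Proof.
move=> pP pU /path_edges_split[q [b [r [pE eE]]]].
exists (last x q), b; split=> //.
all: have := path_edges_uniq pU; move: pP.
all: rewrite path_edgesE {}pE path_edges_cat /= cat_uniq all_cat /= -eE.
all: move=> /and3P[qF eF rF] /and4P[_ /norP[eq _] er _].
- apply/connectP; exists q => //; rewrite path_edgesE.
  apply/allP => g gq; rewrite !inE (allP qF) // andbT.
  by apply: contraNneq eq => <-.
- rewrite last_cat /=; apply/connectP; exists r => //; rewrite path_edgesE.
  apply/allP => g gr; rewrite !inE (allP rF) // andbT.
  by apply: contraNneq er => <-.
Qed.

Lemma conflict_freeI (col : {set G} -> nat) x p e :
    uniq (x :: p) -> e \in path_edges x p ->
    {in path_edges x p, forall g, col g = col e -> g = e} ->
  conflict_free col x p.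
Proof.
move=> pU ep inj; exists (col e).
rewrite (eq_in_count (a2 := pred1 e)) => [|g gp].
  by rewrite count_uniq_mem ?path_edges_uniq // ep.
by apply/eqP/eqP => [|->] //; apply: inj.
Qed.

Lemma edge_path_is_path F x p : F \subset edges G ->
  path (edge_rel F) x p -> uniq (x :: p) -> is_path x (last x p) p.
Proof.
move=> /subsetP FE pP pU; rewrite /is_path eqxx pU !andbT.
by apply: sub_path pP => a b /FE; rewrite mem_edges.
Qed.

(** * Spanning trees and conflict-free colourings *)

(** An inclusion-minimal spanning edge set serves as the spanning tree; minimality stands in for
    acyclicity. *)
Lemma min_spanning : connected G -> exists T,
  [/\ T \subset edges G, spanning T
    & forall f, f \in T -> ~~ spanning (T :\ f)].
Proof.
move=> Gc; have := spanning_edges Gc.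
move=> /(minset_exists (P := @spanning G))[T /minsetP[Ts Tmin] TE].
exists T; split=> // f fT; apply/negP => /Tmin /(_ (subsetDl _ _)) TfT.
by move: fT; rewrite -TfT !inE eqxx.
Qed.

(* Deleting [f] splits the tree [T] into the side of [x] and the side of [y];
   as [f] is not a bridge, some other edge [g] joins the two sides. *)
Lemma swap_edge T x p f :
    T \subset edges G -> spanning T ->
    (forall f, f \in T -> ~~ spanning (T :\ f)) ->
    path (edge_rel T) x p -> uniq (x :: p) -> f \in path_edges x p ->
    spanning (edges G :\ f) ->
  exists q g,
    [/\ path (edge_rel (edges G)) x q, last x q = last x p & uniq (x :: q)] /\
    [/\ g \in path_edges x q, g \notin T
      & {in path_edges x q, forall e, e = g \/ e \in T}].
Proof.
move=> TE Ts Tmin pP pU fp /spanningP Gf.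
have fT : f \in T by apply: (allP (_ : all _ _)) fp; rewrite -path_edgesE.
have [a [b [fE xa bY]]] := path_edge_sides pP pU fp.
have nab : ~~ connect (edge_rel (T :\ f)) a b.
  by apply: contra (Tmin f fT); rewrite fE; apply: spanning_del_edge.
set y := last x p in bY *.
pose X := [set w | connect (edge_rel (T :\ f)) x w].
have yX : y \notin X.
  rewrite inE; apply: contra nab => xy.
  rewrite edge_connect_sym in xa; apply: connect_trans xa _.
  by apply: connect_trans xy _; rewrite edge_connect_sym.
have xX : x \in X by rewrite inE connect0.
have [u [v [uv uX vX]]] := crossing_edge (Gf x y) xX yX.
have uvT : [set u; v] \notin T.
  apply: contra vX => uvT; move: uX; rewrite !inE => xu.
  apply: connect_trans xu (connect1 _); rewrite /edge_rel in_setD1 uvT andbT.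
  by move: uv; rewrite in_setD1 => /andP[].
(* After deleting [f], the tree joins [v] to [a] or to [b]; joined to [a], it would lie in [X]. *)
have vy : connect (edge_rel (T :\ f)) v y.
  apply: connect_trans bY; rewrite edge_connect_sym.
  have := connect_del_edge b ((spanningP _ Ts) a v); rewrite -fE.
  case/orP=> // av; case/negP: vX; rewrite inE; exact: connect_trans av.
move: uX; rewrite inE => /simple_path_connect[q [qP qu qU]].
have [r [rP ry rU]] := simple_path_connect vy.
(* [q] stays inside [X] and [r] outside, so their concatenation is again simple. *)
have qX w : w \in x :: q -> w \in X.
  by move=> wq; rewrite inE; apply: path_connect wq.
have rX w : w \in v :: r -> w \notin X.
  move=> /(path_connect rP) vw; apply: contra vX; rewrite !inE => xw.
  by apply: connect_trans xw _; rewrite edge_connect_sym.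
have sTf : {subset T :\ f <= T} by move=> e; rewrite inE => /andP[].
have pE : path_edges x (q ++ v :: r) =
    path_edges x q ++ [set u; v] :: path_edges v r.
  by rewrite path_edges_cat qu.
have inT : {in path_edges x (q ++ v :: r), forall e, e = [set u; v] \/ e \in T}.
  move: qP rP; rewrite !path_edgesE => /allP qT /allP rT e.
  rewrite pE mem_cat inE => /or3P[/qT/sTf|/eqP|/rT/sTf]; by [right|left].
exists (q ++ v :: r), [set u; v]; do 2!split=> //.
- rewrite path_edgesE; apply/allP => e /inT[->|/(subsetP TE)] //.
  by move: uv; rewrite inE => /andP[].
- by rewrite last_cat.
- rewrite -cat_cons cat_uniq qU rU andTb andbT; apply/hasPn => w /rX.
  by apply: contra => /qX.
- by rewrite pE mem_cat mem_head orbT.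
Qed.

(** If [p] avoided [e], then [p] and the two pieces of [q] around [e] would join the ends of [e] in
    [edges G :\ e]. *)
Lemma bridge_in_every_path x p q e :
    connected G -> e \in bridges G ->
    path (edge_rel (edges G)) x p -> path (edge_rel (edges G)) x q ->
    last x p = last x q -> uniq (x :: q) ->
  e \in path_edges x q -> e \in path_edges x p.
Proof.
move=> /spanning_edges sG; rewrite inE => /andP[_ nsp] pP qP pq qU eq.
have [a [b [eE xa bY]]] := path_edge_sides qP qU eq.
apply: contraNT nsp => ep.
have xy : connect (edge_rel (edges G :\ e)) x (last x q).
  apply/connectP; exists p => //; move: pP; rewrite !path_edgesE.
  move=> /allP pG; apply/allP => g gp; rewrite !inE pG // andbT.
  by apply: contraNneq ep => <-.
rewrite {1}eE; apply: spanning_del_edge => //; rewrite -eE.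
rewrite edge_connect_sym in xa; apply: connect_trans xa _.
by apply: connect_trans xy _; rewrite edge_connect_sym.
Qed.

Lemma few_bridges_cf_colorable k :
  connected G -> 1 < k -> #|bridges G| <= k -> cf_colorable G k.
Proof.
move=> Gc k1 Bk; have [T [TE Ts Tmin]] := min_spanning Gc.
have BT e : e \in bridges G -> e \in T.
  rewrite inE => /andP[_]; apply: contraR => eT; apply/spanningP => x y.
  apply: edge_connect_sub ((spanningP _ Ts) x y).
  by rewrite subsetD1 TE.
(* Bridge colours are positions in an enumeration: the first bridge shares colour 0 with the other
   tree edges, the second shares colour 1 with the edges outside [T]. *)
pose col e := if e \in bridges G then index e (enum (bridges G))
              else if e \in T then 0 else 1.
have colB e : e \in bridges G -> col e = index e (enum (bridges G)).
  by rewrite /col => ->.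
have col_inj : {in bridges G &, injective col}.
  move=> e f eB fB; rewrite !colB // => ef.
  by rewrite -(nth_index e (s := enum (bridges G)) (x := e)) ?mem_enum // ef
             nth_index ?mem_enum.
(* Among tree edges a positive colour occurs only on bridges, whose colours are distinct. *)
have colT e f : e \in T -> 0 < col f -> col e = col f -> f \in bridges G ->
    e = f.
  move=> eT f0 ef fB; apply: col_inj => //; apply: contraTT f0 => eB.
  by rewrite -ef /col (negPf eB) eT.
exists col => [e _|x y xy].
  rewrite /col; case: ifP => [eB|_]; last by case: ifP; lia.
  by apply: leq_trans Bk; rewrite cardE index_mem mem_enum.
have [p [pP py pU]] := simple_path_connect ((spanningP _ Ts) x y).
have pT : {in path_edges x p, forall e, e \in T}.
  by apply/allP; rewrite -path_edgesE.
have pE : path (edge_rel (edges G)) x p.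
  by apply: sub_path pP => a b /(subsetP TE).
have [/hasP[g gp /andP[gB g0]]|noB] :=
  boolP (has (fun e => (e \in bridges G) && (0 < col e)) (path_edges x p)).
  exists p; first by rewrite -py (edge_path_is_path (F := T)).
  by apply: (conflict_freeI (e := g)) => // e /pT eT ef; apply: colT.
have noB' e : e \in path_edges x p -> e \in bridges G -> col e = 0.
  move=> ep eB; apply/eqP; rewrite -leqn0 leqNgt; apply: contra noB => e0.
  by apply/hasP; exists e; rewrite ?eB.
have [/allP pB|/allPn[f fp fB]] :=
  boolP (all [in bridges G] (path_edges x p)).
  exists p; first by rewrite -py (edge_path_is_path (F := T)).
  case: p {pP pE noB} py pU pT noB' pB => [xy'|z p _ pU _ _ pB].
    by rewrite -xy' eqxx in xy.
  apply: (conflict_freeI (e := [set x; z])) => //; first exact: mem_head.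
  by move=> e ep; apply: col_inj; apply: pB => //; apply: mem_head.
have Gf : spanning (edges G :\ f).
  by move: fB; rewrite inE (subsetP TE) ?pT //= negbK.
have [q [g [[qE qp qU] [gq gT qT]]]] := swap_edge TE Ts Tmin pP pU fp Gf.
have colg : col g = 1.
  by rewrite /col (negPf gT) ifN //; apply: contra gT; apply: BT.
exists q; first by rewrite -py -qp (edge_path_is_path (F := edges G)).
apply: (conflict_freeI (e := g)) => // e eq; rewrite colg => e1.
have [//|eT] := qT e eq; have [eB|eB] := boolP (e \in bridges G).
  have := bridge_in_every_path Gc eB pE qE (esym qp) qU eq.
  by move=> /noB' /(_ eB); rewrite e1.
by move: e1; rewrite /col (negPf eB) eT.
Qed.

(** * Counting edges in the presence of bridges *)

(** [R] picks vertices from distinct components, by induction on [D]. On deleting a further bridge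
    [d], a vertex no longer reachable from [R] is added. If there were none, both ends of [d] would
    be reached from [R], necessarily from the same vertex, hence joined without [d]. *)
Lemma separated_set D :
    connected G -> 0 < #|G| -> D \subset bridges G ->
  exists R : {set G}, #|R| = #|D|.+1 /\
    {in R &, forall x y, connect (edge_rel (edges G :\: D)) x y -> x = y}.
Proof.
move=> Gc /card_gt0P[x0 _]; move Dm: #|D| => m; elim: m D Dm => [|m IH] D Dm DB.
  by exists [set x0]; rewrite cards1; split=> // x y /set1P-> /set1P->.
have /card_gt0P[d dD] : 0 < #|D| by rewrite Dm.
have Ddm : #|D :\ d| = m by have := cardsD1 d D; rewrite dD Dm; lia.
have [|R [Rm Rsep]] := IH _ Ddm; first exact: subset_trans (subsetDl _ _) DB.
have := subsetP DB d dD; rewrite inE => /andP[dG].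
have [u [v dE]] := edgesP dG; move=> d_bridge.
have DsubDd x y : connect (edge_rel (edges G :\: D)) x y ->
    connect (edge_rel (edges G :\: (D :\ d))) x y.
  by apply/edge_connect_sub/setDS/subsetDl.
have [[w wR]|closeR] := pselect (exists w, {in R, forall r,
    ~~ connect (edge_rel (edges G :\: D)) r w}).
  exists (w |: R).
  have wnR : w \notin R by apply/negP => /wR; rewrite connect0.
  split; first by rewrite cardsU1 wnR Rm.
  move=> x y /setU1P[->|xR] /setU1P[->|yR] // xy.
  - by move: (wR y yR); rewrite edge_connect_sym xy.
  - by move: (wR x xR); rewrite xy.
  - exact/Rsep/DsubDd.
have close w : exists2 r, r \in R & connect (edge_rel (edges G :\: D)) r w.
  apply: contrapT => h; apply: closeR; exists w => r rR.
  by apply/negP => rw; apply: h; exists r.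
have [[r rR ru] [s sR sv]] := (close u, close v).
have rs : r = s.
  apply: Rsep => //; apply: connect_trans (DsubDd _ _ ru) _.
  rewrite edge_connect_sym; apply: connect_trans (DsubDd _ _ sv) _.
  apply: connect1; rewrite /edge_rel setUC -dE !inE eqxx /=; exact: dG.
case/negP: d_bridge; rewrite dE; apply: spanning_del_edge.
  exact: spanning_edges.
rewrite -rs in sv; rewrite edge_connect_sym in ru.
rewrite -dE; apply: edge_connect_sub (connect_trans ru sv).
by apply: setDS; rewrite sub1set.
Qed.

(** With N the sum of all [s i - 1], each [s i] is at most N + 1, so [s i * (s i - 1)] is at most
    [(N + 1) * (s i - 1)]; these bounds sum to (N + 1)N. *)
Lemma sum_bin2_le (I : finType) (P : {set I}) (s : I -> nat) :
    (forall i, i \in P -> 0 < s i) ->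
  \sum_(i in P) 'C(s i, 2) <= 'C((\sum_(i in P) s i - #|P|).+1, 2).
Proof.
move=> s0; set N := _ - _.
have NE : N = \sum_(i in P) (s i).-1.
  rewrite /N -sum1_card; apply/eqP.
  rewrite (eq_bigr (fun i => (s i).-1 + 1)) => [|i /s0]; last by lia.
  by rewrite big_split addnK.
rewrite -(leq_pmul2l (isT : 0 < 2)) big_distrr -mul_bin_diag bin1 /= {2}NE.
rewrite big_distrr; apply: leq_sum => i iP.
rewrite -mul_bin_diag bin1 leq_mul2r; apply/orP; right.
have : (s i).-1 <= N by rewrite NE (bigD1 i) //= leq_addr.
lia.
Qed.

Lemma connected_with_bridges D :
    connected G -> 0 < #|G| -> D \subset bridges G ->
  #|D| < #|G| /\ #|edges G| <= 'C(#|G| - #|D|, 2) + #|D|.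
Proof.
move=> Gc G0 DB; have [R [RD Rsep]] := separated_set Gc G0 DB.
have DG : #|D| < #|G| by rewrite -RD max_card.
split=> //; pose e := connect (edge_rel (edges G :\: D)).
have e_equiv : {in [set: G] & &, equivalence_rel e}.
  move=> x y z _ _ _; split=> [|xy]; first exact: connect0.
  by apply: same_connect => //; apply: edge_connect_sym.
pose P := equivalence_partition e [set: G].
have Ppart : partition P [set: G] := equivalence_partitionP e_equiv.
(* Members of [R] lie in distinct components, hence in distinct blocks of [P]. *)
have RP : #|R| <= #|P|.
  have pblock_inj : {in R &, injective (pblock P)}.
    move=> x y xR yR xy; apply: Rsep => //.
    rewrite -[connect _ _ _](pblock_equivalence_partition e_equiv) ?inE //.
    by rewrite -/P xy mem_pblock (cover_partition Ppart) inE.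
  rewrite -(card_in_imset pblock_inj); apply/subset_leq_card/subsetP.
  by move=> _ /imsetP[x _ ->]; rewrite pblock_mem ?(cover_partition Ppart).
(* Each remaining edge is a two-element subset of one block. *)
have ED : #|edges G :\: D| <= \sum_(A in P) 'C(#|A|, 2).
  pose S (A : {set G}) : {set {set G}} := [set f : {set G} | f \subset A & #|f| == 2].
  rewrite (eq_bigr (fun A => #|S A|)) => [|A _]; last by rewrite cards_draws.
  apply: leq_trans (_ : #|\bigcup_(A in P) S A| <= _); last first.
    elim/big_ind2: _ => [|? ? ? ? h1 h2|//]; first by rewrite cards0.
    exact: leq_trans (leq_card_setU _ _) (leq_add h1 h2).
  apply/subset_leq_card/subsetP => f fED.
  have := fED; rewrite inE => /andP[_ fE]; have [x [y fxy]] := edgesP fE.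
  apply/bigcupP; exists (pblock P x).
    by rewrite pblock_mem // (cover_partition Ppart).
  rewrite inE fxy cards2 subUset !sub1set mem_pblock.
  rewrite (cover_partition Ppart) !inE pblock_equivalence_partition ?inE //=.
  have -> : e x y by apply: connect1; rewrite /edge_rel -fxy.
  by move: fE; rewrite fxy mem_edges; case: (x =P y) => //= ->; rewrite adj_irrefl.
rewrite -(cardsID D (edges G)) addnC; apply: leq_add; last first.
  by apply: subset_leq_card; apply: subsetIr.
apply: leq_trans ED _; apply: leq_trans (sum_bin2_le _) _.
  move=> A AP; rewrite card_gt0; apply: contraTneq AP => ->.
  by case/and3P: Ppart.
(* [P] has at least [#|D| + 1] blocks, which absorbs the successor in the binomial. *)
rewrite -(card_partition Ppart) cardsT; apply: leq_bin2l; lia.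
Qed.

End Graphs.

(** * The extremal graph: a clique with pendant edges *)

Section Extremal.
Variables c k : nat.

(** The [inl] vertices form the clique, and the [inr] vertices are leaves at [inl ord0]. The
    successors make both parts nonempty, so the hub always exists. *)
Definition clique_star_adj : rel ('I_c.+1 + 'I_k.+1) := fun u v =>
  match u, v with
  | inl i, inl j => i != j
  | inl i, inr _ | inr _, inl i => i == ord0
  | inr _, inr _ => false
  end.

Lemma clique_star_sym : symmetric clique_star_adj.
Proof. by case=> i [] j //=; rewrite eq_sym. Qed.

Lemma clique_star_irrefl : irreflexive clique_star_adj.
Proof. by case=> i //=; rewrite eqxx. Qed.

Definition clique_star : sgraph := SGraph clique_star_sym clique_star_irrefl.

Let hub : clique_star := inl ord0.
Let leaf (i : 'I_k.+1) : clique_star := inr i.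

Lemma card_clique_star : #|clique_star| = (c + k + 2)%N.
Proof. by rewrite card_sum !card_ord; lia. Qed.

Lemma clique_star_connected : connected clique_star.
Proof.
have hubP x : connect (@adj clique_star) hub x.
  case: x => i; last exact: connect1.
  have [->|i0] := eqVneq i ord0; first exact: connect0.
  by apply: connect1; rewrite /= eq_sym.
move=> x y; apply: connect_trans (hubP y).
by rewrite (sym_connect_sym (@adj_sym clique_star)).
Qed.

Lemma clique_star_edges : 'C(c.+1, 2) + k.+1 <= #|edges clique_star|.
Proof.
pose K : {set clique_star} := [set inl i | i in 'I_c.+1].
pose A := [set e : {set clique_star} | e \subset K & #|e| == 2].
pose P := [set [set hub; leaf i] | i in 'I_k.+1].
have cA : #|A| = 'C(c.+1, 2).
  by rewrite cards_draws card_imset ?card_ord //; apply: inl_inj.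
have cP : #|P| = k.+1.
  rewrite card_imset ?card_ord // => i j /setP/(_ (leaf i)).
  by rewrite !inE eqxx /= => /esym/eqP[].
have AP : A :&: P = set0.
  apply/setP => e; rewrite !inE; apply/negP => /andP[/andP[eK _]].
  case/imsetP => i _ eE; have : leaf i \in K.
    by apply: (subsetP eK); rewrite eE set22.
  by case/imsetP.
rewrite -cA -cP -[X in X <= _](subn0) -(cards0 {set clique_star}) -AP -cardsU.
apply/subset_leq_card/subsetP => e; rewrite inE.
case/orP => [|/imsetP[i _ ->]]; last by rewrite mem_edges /=.
rewrite inE => /andP[/subsetP eK /cards2P[u [v [uv eE]]]].
rewrite {}eE in eK *; rewrite mem_edges.
have /imsetP[i _ ui] := eK u (set21 _ _).
have /imsetP[j _ vj] := eK v (set22 _ _).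
by rewrite ui vj in uv *.
Qed.

(** The hub is the only neighbour of a leaf, so it comes second and second to last; a simple path
    visits it once. *)
Lemma leaf_path i j p : i != j -> is_path (leaf i) (leaf j) p ->
  p = [:: hub; leaf j].
Proof.
have adj_leaf x l : adj (leaf l) x -> x = hub by case: x => //= m /eqP->.
move=> ij /and3P[]; case: p => [_ /eqP ij'|z p].
  by case: ij' ij => ->; rewrite eqxx.
rewrite [path _ _ _]/= => /andP[iz]; rewrite (adj_leaf z i iz) => {iz}.
case/lastP: p => // p x; rewrite rcons_path last_cons last_rcons.
move=> /andP[_ px] /eqP xj; rewrite {}xj in px *.
have {px} : last hub p = hub by apply: (adj_leaf _ j); rewrite adj_sym.
case: p => // w p /= wE /and3P[_ hub_notin _]; case/negP: hub_notin.
by rewrite -rcons_cons mem_rcons in_cons -wE mem_last orbT.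
Qed.

(** By pigeonhole two of the [k + 1] pendant edges share a colour, and the only path between their
    leaves consists of these two edges. *)
Lemma clique_star_not_colorable : ~ cf_colorable clique_star k.
Proof.
case=> col colk cfc.
have Hk i : col [set leaf i; hub] < k by apply: colk; rewrite mem_edges.
have /injectivePn[i [j ij eq_ij]] :
    ~~ injectiveb (fun i => Ordinal (Hk i)).
  apply/injectiveP => /leq_card; rewrite !card_ord; lia.
move/(congr1 val): eq_ij => /= eq_ij.
have [|p /(leaf_path ij) -> [a]] := cfc (leaf i) (leaf j).
  by apply: contra ij => /eqP[->].
(* Every colour now occurs 0 or 2 times on the path. *)
rewrite /= [[set hub; _]]setUC eq_ij.
by case: eqP.
Qed.

End Extremal.

(** * From colourings to the edge threshold *)

Lemma cfc_leq (G : sgraph) (Gc : connected G) k :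
  cf_colorable G k -> cfc Gc <= k.
Proof.
rewrite /cfc => h; case: ex_minnP => m _; apply; exact/asboolP.
Qed.

Lemma cf_colorable_cfc (G : sgraph) (Gc : connected G) :
  cf_colorable G (cfc Gc).
Proof. by rewrite /cfc; case: ex_minnP => m /asboolP. Qed.

Lemma cf_colorable_leq (G : sgraph) c d :
  c <= d -> cf_colorable G c -> cf_colorable G d.
Proof.
move=> cd [col colc colP]; exists col => // e eG.
exact: leq_trans (colc e eG) cd.
Qed.

Lemma exists_subset_card (I : finType) (A : {set I}) m :
  m <= #|A| -> exists2 D : {set I}, D \subset A & #|D| = m.
Proof.
case/card_geqP => s [sU sz sA]; exists [set:: s].
  by apply/subsetP => x; rewrite inE => /sA.
by rewrite cardsE (card_uniqP sU).
Qed.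

(** The condition on [m] is guarded because [k + 1] bridges force [k + 1 < n]; for [k = n - 1] every
    integer is therefore a bound. *)
Lemma cfc_edge_boundI n k (m : int) : 1 < k -> k < n ->
  (k < n.-1 -> (Posz ('C(n - k - 1, 2) + k + 2) <= m)%R) ->
  cfc_edge_bound n k m.
Proof.
move=> k1 kn hm G Gc Gn mG; apply/cfc_leq/few_bridges_cf_colorable => //.
rewrite leqNgt; apply/negP => /exists_subset_card[D DB Dk].
have [|] := connected_with_bridges Gc _ DB; first by rewrite Gn; lia.
rewrite Dk Gn => kn1 leE.
have /hm h : k < n.-1 by lia.
have := Order.POrderTheory.le_trans h mG; rewrite lez_nat.
move: leE; rewrite (_ : n - k.+1 = n - k - 1); lia.
Qed.

Lemma cfc_edge_bound_geq n k (m : int) : k < n.-1 ->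
  cfc_edge_bound n k m -> (Posz ('C(n - k - 1, 2) + k + 2) <= m)%R.
Proof.
move=> kn bm; rewrite Order.TotalTheory.leNgt; apply/negP => mlt.
(* This choice gives order [c + k + 2 = n] and a clique on [n - k - 1] vertices; the edge count is
   at least one less than the claimed threshold, hence at least [m]. *)
set c := n - k - 2.
have Gc := @clique_star_connected c k.
apply: (@clique_star_not_colorable c k).
apply: cf_colorable_leq (cf_colorable_cfc Gc); apply: bm.
  by rewrite card_clique_star; lia.
have := clique_star_edges c k; rewrite (_ : c.+1 = n - k - 1); last by lia.
move: mlt; lia.
Qed.

Theorem theorem3p3 (n k : nat) (hk : (2 <= k)%N) (hkn : (k <= n - 1)%N) :
  (forall m : int, is_f n k m -> m = Posz ('C(n - k - 1, 2) + k + 2)%N) /\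
  ((k < n - 1)%N -> is_f n k (Posz ('C(n - k - 1, 2) + k + 2)%N)).
Proof.
have is_fI : k < n - 1 -> is_f n k (Posz ('C(n - k - 1, 2) + k + 2)).
  rewrite subn1 => kn; split=> [|m']; last exact: cfc_edge_bound_geq.
  by apply: cfc_edge_boundI; lia.
split=> // m [bm minm].
have [kn|nk] := ltnP k (n - 1).
  have [bM minM] := is_fI kn.
  by apply/eqP; rewrite Order.POrderTheory.eq_le minm // minM.
(* For [k = n - 1] the bound [m - 1] contradicts the minimality of [m], so no value of [f]
   exists. *)
have /minm : cfc_edge_bound n k (m - 1)%R by apply: cfc_edge_boundI; lia.
lia.
Qed.
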